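(* Let $D$ be a skew diagram, i.e. $D=\mathbb{S}(\alpha)$ for some weak composition $\alpha$. Then $\mathrm{MaxG}(D)=\mathrm{sf}(D)$.
   Context: A diagram is a finite set of cells at positions $(r,c)$ with $r,c$ positive integers ($r$ = row, counted from the bottom; $c$ = column), at most one cell per position; each cell is either an ordinary cell, written $(r,c)$, or a ghost cell, written $\langle r,c\rangle$. A position is empty if it contains no cell of either kind. K-Kohnert move at row $r$ of a diagram $D$: let the rightmost cell of row $r$ (ghost or not) lie in column $c$. The move does nothing if (i) that cell is a ghost cell, or (ii) every position $(r',c)$ with $r'<r$ is occupied, or (iii) letting $\hat r<r$ be maximal with $(\hat r,c)$ empty, some position $(r^*,c)$ with $\hat r<r^*<r$ holds a ghost cell. Otherwise there are two choices: the Kohnert move moves the cell from $(r,c)$ to $(\hat r,c)$; the ghost move moves the cell from $(r,c)$ to $(\hat r,c)$ and places a ghost cell $\langle r,c\rangle$ in position $(r,c)$. $KKD(D)$ is the set consisting of $D$ and all diagrams obtained from $D$ by finite sequences of K-Kohnert moves. $\mathrm{MaxG}(D)=\max\{|G(T)| : T\in KKD(D)\}$ where $G(T)$ is the set of ghost cells of $T$. Snow diagram: for a diagram $D$ with no ghost cells, process the rows from top to bottom; in each row, mark the rightmost cell of that row which has no already-marked cell above it in the same column (if such a cell exists). Marked cells are dark clouds. Then place a snowflake in every empty position lying strictly below some dark cloud in the same column. $\mathrm{sf}(D)$ is the number of snowflakes. Skew diagram: for a weak composition $\alpha=(\alpha_1,\dots,\alpha_n)$, $\mathbb{S}(\alpha)$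 is built as follows: left-justify $\alpha_i$ cells in row $i$ for each $i\in[n]$; then for $j$ from $1$ to $n$ with $\alpha_j>0$, take $i<j$ maximal with $\alpha_i>0$ (if it exists), and if $\alpha_i>\alpha_j$, shift all rows $k\ge j$ to the right by $\alpha_i-\alpha_j$ columns; finally shift each row $j\in[n]$ to the right by $|\{i : 1\le i<j,\ \alpha_i=0\}|$ columns. All cells are ordinary cells. *)

(* Defs.v *)
From HB Require Import structures.
From mathcomp Require Import all_boot.
From mathcomp Require Import finmap.
From mathcomp Require Import boolp.

Set Implicit Arguments.
Unset Strict Implicit.
Unset Printing Implicit Defensive.

Local Open Scope fset_scope.
Local Open Scope fmap_scope.
Local Open Scope nat_scope.

Inductive cell := Ordinary | Ghost.

Definition cell_is_ghost (k : cell) : bool :=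
  if k is Ghost then true else false.

Lemma cell_is_ghostK :
  cancel cell_is_ghost (fun b => if b then Ghost else Ordinary).
Proof. by case. Qed.

HB.instance Definition _ := Countable.copy cell (can_type cell_is_ghostK).

(* A position is (row, column); both coordinates are positive integers, rows
   are counted from the bottom.  The constructions below never put a cell
   at a position having a zero coordinate. *)
Definition position : Type := (nat * nat)%type.

Definition diagram : Type := {fmap position -> cell}.

Implicit Types (D T : diagram) (r c : nat).

Definition is_empty D (p : position) : bool := D.[? p] == None.
Definition is_ghost D (p : position) : bool := D.[? p] == Some Ghost.

Definition ghosts D : {fset position} := [fset p in domf D | is_ghost D p].

Definition rightmost D r c : Prop :=
  ~~ is_empty D (r, c) /\ forall c', c < c' -> is_empty D (r, c').

Definition highest_empty_below D r c r' : Prop :=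
  [/\ 0 < r', r' < r, is_empty D (r', c) &
      forall s, r' < s -> s < r -> ~~ is_empty D (s, c)].

(* The K-Kohnert move at row r is not blocked: it moves the cell at (r, c),
   rightmost in its row, down to (r', c). *)
Definition can_move D r c r' : Prop :=
  [/\ rightmost D r c, ~~ is_ghost D (r, c), highest_empty_below D r c r' &
      forall s, r' < s -> s < r -> ~~ is_ghost D (s, c)].

Definition kohnert_move D r c r' : diagram :=
  D.[~ (r, c)].[(r', c) <- Ordinary].

Definition ghost_move D r c r' : diagram :=
  D.[(r', c) <- Ordinary].[(r, c) <- Ghost].

(* [KKD D T] is T \in KKD(D).  Moves that do nothing are omitted. *)
Inductive KKD D : diagram -> Prop :=
| KKD_refl : KKD D D
| KKD_kohnert T r c r' :
    KKD D T -> can_move T r c r' -> KKD D (kohnert_move T r c r')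
| KKD_ghost T r c r' :
    KKD D T -> can_move T r c r' -> KKD D (ghost_move T r c r').

Definition ghost_number D : pred nat :=
  fun m => `[< exists2 T, KKD D T & #|` ghosts T| = m >].

Lemma ghost_number_ex D : exists m, ghost_number D m.
Proof.
by exists #|` ghosts D|; apply/asboolP; exists D => //; exact: KKD_refl.
Qed.

Definition KKD_box D : {fset position} :=
  [fset p in [seq (r, q.2) | q : position <- domf D, r <- iota 0 q.1.+1]].

Lemma KKD_boxP D p :
  reflect (exists2 q, q \in domf D & p.1 <= q.1 /\ p.2 = q.2)
          (p \in KKD_box D).
Proof.
rewrite inE; apply: (iffP allpairsPdep) => [[q [r [qD]]]|[q qD [le_pq eq_pq]]].
  by rewrite mem_iota /= add0n ltnS => le_rq ->; exists q.
exists q, p.1; split => //; first by rewrite mem_iota /= add0n ltnS.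
by rewrite -eq_pq -surjective_pairing.
Qed.

Lemma KKD_sub_box D T : KKD D T -> domf T `<=` KKD_box D.
Proof.
have step T' r c r' : domf T' `<=` KKD_box D -> can_move T' r c r' ->
    (r, c) \in KKD_box D /\ (r', c) \in KKD_box D.
  move=> /fsubsetP sub [[rc _] _ [_ lt_r _ _] _].
  have rcD : (r, c) \in domf T' by apply: contraR rc => /not_fnd /eqP.
  have [q qD [le_rq eq_cq]] := KKD_boxP _ _ (sub _ rcD).
  split; first exact: sub.
  apply/KKD_boxP; exists q => //; split=> //.
  exact: leq_trans (ltnW lt_r) _.
elim=> [|T' r c r' _ sub /(step _ _ _ _ sub)[rcB r'cB]
        |T' r c r' _ sub /(step _ _ _ _ sub)[rcB r'cB]].
- by apply/fsubsetP=> p pD; apply/(KKD_boxP D p); exists p.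
- apply/fsubsetP=> p; rewrite dom_setf in_fset1U => /orP[/eqP->//|].
  by rewrite mem_remf => /andP[_ pT]; exact: (fsubsetP sub).
- apply/fsubsetP=> p; rewrite !dom_setf !in_fset1U.
  by move=> /or3P[/eqP->//|/eqP->//|pT]; exact: (fsubsetP sub).
Qed.

Lemma ghost_number_le D m : ghost_number D m -> m <= #|` KKD_box D|.
Proof.
move=> /asboolP[T /KKD_sub_box sub <-].
by apply/fsubset_leq_card/(fsubset_trans _ sub); exact: fset_sub.
Qed.

Definition MaxG D : nat :=
  ex_maxn (ghost_number_ex D) (@ghost_number_le D).

Definition markable D (M : {fset position}) r : {fset nat} :=
  [fset p.2 | p in domf D & (p.1 == r) &&
     ~~ has (fun q : position => (r < q.1) && (q.2 == p.2)) M].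

Definition mark_row D r (M : {fset position}) : {fset position} :=
  let C := markable D M r in
  if C == fset0 then M else (r, \max_(c <- C) c) |` M.

Definition height D : nat := \max_(p <- domf D) p.1.

(* [foldr] applies [mark_row] to the last element of the list first, so the
   rows are processed from top to bottom. *)
Definition dark_clouds D : {fset position} :=
  foldr (mark_row D) fset0 (iota 1 (height D)).

Definition snowflakes D : {fset position} :=
  [fset p in [seq (r, q.2) | q : position <- dark_clouds D, r <- iota 1 q.1.-1]
     | is_empty D p].

Definition sf D : nat := #|` snowflakes D|.

(* A weak composition (alpha_1, ..., alpha_n) is a list of naturals; [part]
   and the functions below are 1-indexed and only meant for j >= 1. *)
Implicit Type alpha : seq nat.

Definition part alpha j : nat := nth 0 alpha j.-1.

(* The last nonzero entry among alpha_1, ..., alpha_(j-1), or 0 if none. *)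
Definition prev_part alpha j : nat :=
  last 0 [seq a <- take j.-1 alpha | 0 < a].

(* Row k is shifted at each step j <= k.  The truncated subtraction is zero
   unless the previous nonzero entry exists and exceeds alpha_j. *)
Definition step_shift alpha k : nat :=
  \sum_(1 <= j < k.+1 | 0 < part alpha j) (prev_part alpha j - part alpha j).

Definition zero_shift alpha j : nat := count_mem 0 (take j.-1 alpha).

Definition skew_cells alpha : {fset position} :=
  [fset p in [seq (r, step_shift alpha r + zero_shift alpha r + c)
             | r <- iota 1 (size alpha), c <- iota 1 (part alpha r)]].

Definition skew alpha : diagram := [fmap p : skew_cells alpha => Ordinary].

(* Main.v *)
(* Lower bound.  Treat the rows from bottom to top, and the cells of a row from
   right to left down to its dark cloud: cells to the right of the dark cloud
   drop to the bottom of their column by Kohnert moves, then the dark cloud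
   drops by ghost moves.  Since the row ends are monotone, the columns to the
   right are never stacked higher, so nothing gets in the way, and every dark
   cloud leaves one ghost per empty position below it.

   Upper bound.  Let the cells of a column keep their vertical order, so that
   a move shifts a block of cells down by one, and label a ghost by the
   original row k of the cell just below it.  The cells of a given original row
   stay weakly descending from left to right, hence the labels of the ghosts in
   a given row increase strictly with the column.  If column c has e(k, c)
   empty positions below row k, a ghost with label k in row r and column c gets
   two ranks t = k + 1 - r and u with t + u = e(k, c) + 1, and it is determined
   by (k, t) as well as by (c, u).  So, if e(k, c) <= y k + w c for all cells
   (k, c), there are at most sum y + sum w ghosts: each has t <= y k or
   u <= w c.  Koenig covers for the greedy matching of rows with columns given
   by the dark clouds, one for each row of empty positions, provide such
   weights with sum y + sum w <= sf. *)

Require Import Defs.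
From mathcomp Require Import all_boot.
From mathcomp Require Import finmap boolp zify.

Set Implicit Arguments.
Unset Strict Implicit.
Unset Printing Implicit Defensive.

Local Open Scope fset_scope.
Local Open Scope fmap_scope.
Local Open Scope nat_scope.

(** * Dark clouds *)

(** The state once the rows from [i] up are processed. The last clause records greediness: a cell is
    weakly left of the dark cloud of its row or strictly below one of its column. *)
Definition darkening (D : diagram) (i : nat) (M : {fset position}) : Prop :=
  [/\ forall k c, (k, c) \in M -> (k, c) \in domf D /\ i <= k,
      forall k l c, (k, c) \in M -> (l, c) \in M -> k = l,
      forall k c d, (k, c) \in M -> (k, d) \in M -> c = d &
      forall k c, (k, c) \in domf D -> i <= k ->
        (exists2 d, c <= d & (k, d) \in M) \/ (exists2 l, k < l & (l, c) \in M)].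

Lemma markableP (D : diagram) M r c :
  reflect ((r, c) \in domf D /\ forall l, r < l -> (l, c) \notin M)
          (c \in markable D M r).
Proof.
apply: (iffP (imfsetP _ _ _ _)) => /=.
  case=> -[k d] /=; rewrite inE /= => /and3P[kD /eqP <- /hasPn nM] ->.
  split=> // l lt_kl; apply/negP => lM.
  by have /= := nM _ lM; rewrite lt_kl eqxx.
case=> rD nM; exists (r, c) => //; rewrite inE /= rD eqxx /=.
apply/hasPn => -[l d] lM /=; apply/negP => /andP[lt_rl /eqP eq_dc].
by move: (nM _ lt_rl); rewrite -eq_dc lM.
Qed.

Lemma bigmax_fset_in (C : {fset nat}) : C != fset0 -> \max_(c <- C) c \in C.
Proof.
case/fset0Pn=> c0 c0C; suff H (s : seq nat) : s != [::] -> \max_(c <- s) c \in s.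
  by apply: H; case: (enum_fset C) (c0C : c0 \in enum_fset C).
elim: s => // a s IH _; rewrite big_cons.
case: s IH => [|b s] IH; first by rewrite big_nil maxn0 mem_head.
by case: leqP => _; rewrite ?mem_head // in_cons IH ?orbT.
Qed.

Lemma darkening_mark_row (D : diagram) i M :
  darkening D i.+1 M -> darkening D i (mark_row D i M).
Proof.
case=> sub col row dom; rewrite /mark_row.
set C := markable D M i; case: (eqVneq C fset0) => [C0|Cn0].
  split=> // [k c /sub[kD /ltnW]//|k c kD].
  rewrite leq_eqVlt => /orP[/eqP eq_ik|]; last exact: dom.
  rewrite -eq_ik in kD *; right; apply: contrapT => nM.
  suff : c \in C by rewrite C0.
  by apply/markableP; split=> // l lt_il; apply/negP => lM; apply: nM; exists l.
have /markableP[mD mM] := bigmax_fset_in Cn0.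
have mmax c : c \in C -> c <= \max_(c <- C) c.
  by move=> cC; apply: (@leq_bigmax_seq _ (enum_fset C) xpredT id).
move: (\max_(c <- C) c) mD mM mmax => m mD mM mmax.
have in1 k c : (k, c) \in (i, m) |` M -> (k = i /\ c = m) \/ (i < k /\ (k, c) \in M).
  rewrite in_fset1U => /orP[/eqP[-> ->]|kM]; first by left.
  by right; split=> //; case: (sub _ _ kM).
split.
- by move=> k c /in1[[-> ->]//|[/ltnW le_ik /sub[]]].
- move=> k l c /in1[[-> ->]|[lt_ik kM]] /in1[[-> e]|[lt_il lM]] //.
  + by case/negP: (mM _ lt_il).
  + by case/negP: (mM _ lt_ik); rewrite -e.
  + exact: col kM lM.
- move=> k c d /in1[[-> ->]|[lt_ik kM]] /in1[[e ->]|[lt_il lM]] //.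
  + by move: lt_il; rewrite ltnn.
  + by move: lt_ik; rewrite e ltnn.
  + exact: row kM lM.
- move=> k c kD; rewrite leq_eqVlt => /orP[/eqP eq_ik|lt_ik]; last first.
    case: (dom k c kD lt_ik) => [] [x le_x xM]; [left|right];
      by exists x => //; rewrite in_fset1U xM orbT.
  rewrite -eq_ik in kD *; case: (boolP (c \in C)) => [/mmax le_cm|cC].
    by left; exists m => //; rewrite in_fset1U eqxx.
  right; apply: contrapT => nM; move/negP: cC; apply.
  apply/markableP; split=> // l lt_il; apply/negP => lM; apply: nM.
  by exists l; rewrite // in_fset1U lM orbT.
Qed.

Lemma dark_cloudsP (D : diagram) : darkening D 1 (dark_clouds D).
Proof.
rewrite /dark_clouds.
have: forall k c, (k, c) \in domf D -> k < 1 + height D.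
  move=> k c kD; rewrite add1n ltnS.
  exact: (@leq_bigmax_seq _ (enum_fset (domf D)) xpredT (fun p => p.1) (k, c)).
elim: (height D) 1 => [|m IH] i bnd /=.
  by split=> // k c /bnd; rewrite addn0 => lt_ki /(leq_trans lt_ki); rewrite ltnn.
apply/darkening_mark_row/IH => k c /bnd; by rewrite addSnnS.
Qed.

(** * Skew shapes *)

(* Row k occupies the columns from [L k] to [R k]; a zero row has
   [L k = (R k).+1], and [R] need not be monotone there. *)
Definition skew_row n (L R : nat -> nat) k : bool := (0 < k <= n) && (L k <= R k).

Definition skew_cell n (L R : nat -> nat) k c : bool :=
  (0 < k <= n) && (L k <= c <= R k).

Definition skew_shaped n (L R : nat -> nat) (D : diagram) : Prop :=
  [/\ forall k c, D.[? (k, c)] = if skew_cell n L R k c then Some Ordinary else None,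
      {homo L : j k / j <= k} &
      forall j k, skew_row n L R j -> skew_row n L R k -> j <= k -> R j <= R k].

Definition row_shift alpha k : nat := step_shift alpha k + zero_shift alpha k.

Lemma step_shiftS alpha k :
  step_shift alpha k.+1 = step_shift alpha k +
    (if 0 < part alpha k.+1 then prev_part alpha k.+1 - part alpha k.+1 else 0).
Proof.
by rewrite /step_shift big_mkcond big_nat_recr //= -big_mkcond.
Qed.

Lemma prev_partS alpha k : 0 < k -> k <= size alpha ->
  prev_part alpha k.+1 = if 0 < part alpha k then part alpha k else prev_part alpha k.
Proof.
case: k => // k _ lt_k; rewrite /prev_part /part /= (take_nth 0) //.
by rewrite filter_rcons; case: ifP; rewrite ?last_rcons.
Qed.

Lemma zero_shift_homo alpha : {homo zero_shift alpha : j k / j <= k}.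
Proof.
move=> j k le_jk; rewrite /zero_shift.
have -> : take j.-1 alpha = take j.-1 (take k.-1 alpha).
  by rewrite take_takel //; lia.
by rewrite -{2}(cat_take_drop j.-1 (take k.-1 alpha)) count_cat leq_addr.
Qed.

Lemma step_shift_homo alpha : {homo step_shift alpha : j k / j <= k}.
Proof.
apply: homo_leq => [//||k]; first exact: leq_trans.
by rewrite step_shiftS leq_addr.
Qed.

(* The last nonzero row weakly below row k ends, before the shifts caused by
   the zero rows, in column [step_shift alpha k + prev_part alpha k.+1]. *)
Lemma right_end_le alpha j k : 0 < j -> j <= k -> k <= size alpha ->
  0 < part alpha j -> 0 < part alpha k ->
  step_shift alpha j + part alpha j <= step_shift alpha k + part alpha k.
Proof.
move=> j0 le_jk le_kn aj ak.
have step i : 0 < i -> i < size alpha ->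
    step_shift alpha i + prev_part alpha i.+1 <=
    step_shift alpha i.+1 + prev_part alpha i.+2.
  by move=> i0 lt_i; rewrite step_shiftS (@prev_partS _ i.+1) //; case: ifP => _; lia.
have: step_shift alpha j + prev_part alpha j.+1 <=
      step_shift alpha k + prev_part alpha k.+1.
  elim: k le_jk le_kn {ak} => [|k IH]; first by lia.
  rewrite leq_eqVlt => /orP[/eqP -> //|lt_jk] lt_k.
  by apply: leq_trans (IH _ _) (step _ _ _); lia.
by rewrite !prev_partS ?aj ?ak //; lia.
Qed.

Lemma skew_skew_shaped alpha :
  skew_shaped (size alpha) (fun k => (row_shift alpha k).+1)
    (fun k => row_shift alpha k + part alpha k) (skew alpha).
Proof.
split.
- move=> k c; set b := skew_cell _ _ _ _ _.
  have -> : b = ((k, c) \in skew_cells alpha).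
    rewrite /skew_cells inE /=; apply/idP/allpairsPdep => [|[r [d []]]].
      rewrite /b /skew_cell /row_shift => /and3P[? ? ?].
      exists k, (c - row_shift alpha k); rewrite !mem_iota /row_shift.
      by split; [lia| lia | congr pair; lia].
    by rewrite !mem_iota /b /skew_cell /row_shift => ? ? [-> ->]; lia.
  case: ifP => [kD|/negbT kD]; last by rewrite not_fnd.
  by rewrite (in_fnd (kD : (k, c) \in domf (skew alpha))) ffunE.
- by move=> j k le_jk; rewrite ltnS leq_add ?step_shift_homo ?zero_shift_homo.
- move=> j k; rewrite /skew_row => /andP[jn aj] /andP[kn ak] le_jk.
  have := zero_shift_homo alpha le_jk.
  have := @right_end_le alpha j k; rewrite /row_shift; lia.
Qed.

(** * Reaching the snowflake count *)

Definition ordinary_upto (T : diagram) r c : nat :=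
  count (fun s => T.[? (s, c)] == Some Ordinary) (iota 1 r).

Lemma ordinary_uptoS T r c :
  ordinary_upto T r.+1 c = ordinary_upto T r c + (T.[? (r.+1, c)] == Some Ordinary).
Proof. by rewrite /ordinary_upto -(addn1 r) iotaD count_cat /= addn0 add1n addn1. Qed.

Lemma ordinary_upto_le T r c : ordinary_upto T r c <= r.
Proof. by rewrite -{2}(size_iota 1 r) count_size. Qed.

Lemma ordinary_upto_homo T c : {homo (ordinary_upto T)^~ c : r s / r <= s}.
Proof.
apply: homo_leq => [//||k]; first exact: leq_trans.
by rewrite ordinary_uptoS leq_addr.
Qed.

(** * Single moves and drops of one cell *)

Definition trace (g : bool) : option cell := if g then Some Ghost else None.

Definition kmove (g : bool) := if g then ghost_move else kohnert_move.

Lemma KKD_kmove D T g r c r' :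
  KKD D T -> can_move T r c r' -> KKD D (kmove g T r c r').
Proof. by case: g => KT /= mv; [exact: KKD_ghost | exact: KKD_kohnert]. Qed.

Lemma fnd_kmove g (T : diagram) r c r' p : r' < r ->
  (kmove g T r c r').[? p] =
    if p == (r, c) then trace g else if p == (r', c) then Some Ordinary else T.[? p].
Proof.
move=> lt_r; have ne : ((r, c) == (r', c)) = false.
  by apply/eqP => -[e]; rewrite e ltnn in lt_r.
case: g; rewrite /= /kohnert_move /ghost_move !fnd_set ?fnd_rem1 /=.
  by [].
by case: (eqVneq p (r, c)) => [->|//]; rewrite ne.
Qed.

(** The cell moves one row at a time, so the ghosts it leaves all stay above it and never block the
    next move. *)
Lemma KKD_drop D g T r c m : KKD D T -> m < r -> T.[? (r, c)] = Some Ordinary ->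
    (forall s, m < s < r -> T.[? (s, c)] = None) ->
    (forall s d, m.+1 < s <= r -> c < d -> T.[? (s, d)] = None) ->
  exists2 T', KKD D T' & forall s d, T'.[? (s, d)] =
    if d == c then
      if s == m.+1 then Some Ordinary
      else if m.+1 < s <= r then trace g else T.[? (s, d)]
    else T.[? (s, d)].
Proof.
elim: r T => // r IH T KT; rewrite ltnS leq_eqVlt => /orP[/eqP -> |lt_mr] Trc emp rgt.
  exists T => // s d; case: eqP => [->|//]; case: eqP => [->//|_].
  by case: ifP => //; lia.
have Tr : T.[? (r, c)] = None by apply: emp; lia.
have mv : can_move T r.+1 c r.
  split.
  - split=> [|d lt_cd]; first by rewrite /is_empty Trc.
    by rewrite /is_empty rgt //; lia.
  - by rewrite /is_ghost Trc.
  - split=> //; [lia | by rewrite /is_empty Tr | lia].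
  - by lia.
have := IH (kmove g T r.+1 c r) (KKD_kmove g KT mv) lt_mr.
case.
- rewrite fnd_kmove // eqxx; case: eqP => // -[]; lia.
- move=> s sP; rewrite fnd_kmove // !xpair_eqE !eqxx !andbT.
  by do 2!(case: eqP => [?|_]; first lia); apply: emp; lia.
- move=> s d sP lt_cd; rewrite fnd_kmove // !xpair_eqE.
  by rewrite [d == c]gtn_eqF // !andbF; apply: rgt => //; lia.
- move=> T' KT' T'E; exists T' => // s d; rewrite T'E fnd_kmove // !xpair_eqE.
  case: (d == c); rewrite ?andbF ?andbT //.
  case: eqP => // ne; case: (eqVneq s r.+1) => [->|ne2].
    by rewrite ltnn andbF leqnn andbT; case: ifP => //; lia.
  have -> : (m.+1 < s <= r.+1) = (m.+1 < s <= r) by lia.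
  by case: (eqVneq s r) => [e|//]; case: ifP => //; lia.
Qed.

Definition dark_row (M : {fset position}) c : option nat :=
  ohead [seq p.1 | p <- enum_fset M & p.2 == c].

Lemma dark_rowP D i M k c : darkening D i M ->
  (dark_row M c == Some k) = ((k, c) \in M).
Proof.
case=> _ col _ _; rewrite /dark_row.
have mem x : (x \in [seq p.1 | p <- enum_fset M & p.2 == c]) = ((x, c) \in M).
  apply/mapP/idP => [[[l d]]|xM].
    by rewrite mem_filter /= => /andP[/eqP -> lM] ->.
  by exists (x, c); rewrite ?mem_filter ?eqxx.
case: [seq _ | _ <- _ & _] mem => [|a s] mem /=; first by rewrite -mem.
have aM : (a, c) \in M by rewrite -mem mem_head.
apply/eqP/idP => [[<-]//|kM]; congr Some; exact: col aM kM.
Qed.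

(* Column c once rows 1, ..., l have been processed: its cells have dropped to
   the bottom, and the dark cloud, if already reached, has left ghosts behind. *)
Definition processed (D : diagram) M l c s : option cell :=
  if dark_row M c is Some k then
    let h := minn l k in
    if 0 < s <= h then
      if s <= ordinary_upto D h c then Some Ordinary else trace (k <= l)
    else D.[? (s, c)]
  else D.[? (s, c)].

(** * Geometry of skew cells and the row-by-row sweep *)

Section SkewShape.
Variables (n : nat) (L R : nat -> nat) (D : diagram) (M : {fset position}).
Hypotheses (skewD : skew_shaped n L R D) (darkM : darkening D 1 M).

Lemma skew_cellE k c : ((k, c) \in domf D) = skew_cell n L R k c.
Proof.
case: skewD => fndD _ _; rewrite -(fndSome D (k, c)) fndD; by case: ifP.
Qed.

Lemma ordinary_skew k c : (D.[? (k, c)] == Some Ordinary) = skew_cell n L R k c.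
Proof. by case: skewD => -> _ _; case: ifP. Qed.

Lemma dark_cell k c : (k, c) \in M -> skew_cell n L R k c.
Proof. by case: darkM => sub _ _ _ /sub[]; rewrite skew_cellE. Qed.

Lemma dark_above k c d : (k, c) \in M -> c < d -> skew_cell n L R k d ->
  exists2 l, k < l & (l, d) \in M.
Proof.
move=> kM lt_cd kd; case: darkM => _ _ row /(_ k d).
case; rewrite ?skew_cellE //; first by case/and3P: kd => /andP[].
by case=> e le_de /(row _ _ _ kM) e_c; lia.
Qed.

Lemma skew_right j k c d : skew_cell n L R k c -> c <= d -> j <= k ->
  skew_cell n L R j d -> skew_cell n L R k d /\ (L j <= c -> skew_cell n L R j c).
Proof.
case: skewD => _ Lh Rh; rewrite /skew_cell => kc le_cd le_jk jd.
have lR : R j <= R k by apply: Rh => //; rewrite /skew_row; lia.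
have lL : L j <= L k by exact: Lh.
by split; lia.
Qed.

Lemma skew_left j k c d : skew_cell n L R k c -> c <= d -> j <= k ->
  skew_cell n L R j d -> skew_cell n L R j c.
Proof.
move=> kc le_cd le_jk jd; have [_] := skew_right kc le_cd le_jk jd.
case: skewD => _ Lh _; have lL : L j <= L k by exact: Lh.
by apply; move: kc; rewrite /skew_cell; lia.
Qed.

Lemma ordinary_upto_right r k c d : skew_cell n L R k c -> c <= d -> r <= k ->
  ordinary_upto D r d <= ordinary_upto D r c.
Proof.
move=> kc le_cd; elim: r => // r IH lt_rk; rewrite !ordinary_uptoS.
apply: leq_add; first exact/IH/ltnW.
rewrite !ordinary_skew; case: (boolP (skew_cell n L R r.+1 d)) => //.
by move=> /(skew_left kc le_cd lt_rk) ->.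
Qed.

(** Intermediate state inside row [r.+1]: its columns from [b] on have been treated, those further
    left have not. *)
Definition sweep r b T := KKD D T /\
  forall s c, T.[? (s, c)] = processed D M (if b <= c then r.+1 else r) c s.

(** If column [d] meets row [r.+1], its dark cloud lies above row [k]: it has left no ghosts yet,
    and the stack in column [d] reaches at most one above the stack of column [b]. Otherwise column
    [d] has no cell up to row [r.+1]. *)
Lemma processed_right r b k s d :
  (k, b) \in M -> r < k -> skew_cell n L R r.+1 b -> b < d ->
  (ordinary_upto D r b).+1 < s <= r.+1 -> processed D M r.+1 d s = None.
Proof.
move=> kM lt_rk rb lt_bd sP; have kb := dark_cell kM.
have Dnone : skew_cell n L R s d = false -> D.[? (s, d)] = None.
  by case: skewD => -> _ _ ->.
case: (boolP (skew_cell n L R r.+1 d)) => [rd|rd].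
  have [l lt_rl lM] : exists2 l, r.+1 < l & (l, d) \in M.
    have [kd _] := skew_right kb (ltnW lt_bd) lt_rk rd.
    by have [l lt_kl lM] := dark_above kM lt_bd kd; exists l => //; lia.
  move: lM; rewrite -(dark_rowP _ _ darkM) /processed => /eqP ->.
  have -> : minn r.+1 l = r.+1 by lia.
  have := ordinary_upto_right rb (ltnW lt_bd) (leqnSn r).
  rewrite ordinary_uptoS ordinary_skew rd => le.
  case: ifP; last by lia.
  by move=> _; case: ifP => [|_]; [lia|rewrite leqNgt lt_rl].
have no j : j <= r.+1 -> skew_cell n L R j d = false.
  move=> le_jr; apply/negP => jd; case/negP: rd.
  by case: (skew_right rb (ltnW lt_bd) le_jr jd).
have D0 : D.[? (s, d)] = None by apply/Dnone/no; lia.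
rewrite /processed; case E: dark_row => [l|//].
have lM : (l, d) \in M by rewrite -(dark_rowP _ _ darkM) E.
have lt_rl : r.+1 < l.
  by rewrite ltnNge; apply/negP => /no; rewrite (dark_cell lM).
rewrite (minn_idPl (ltnW lt_rl)); case: ifP => // _; case: ifP => [|_].
  have -> : ordinary_upto D r.+1 d = 0; last by lia.
  rewrite /ordinary_upto (@eq_in_count _ _ pred0) ?count_pred0 // => j.
  by rewrite mem_iota ordinary_skew => jP; rewrite no //; lia.
by rewrite leqNgt lt_rl.
Qed.

Lemma sweep_step r b T : sweep r b.+1 T -> exists T', sweep r b T'.
Proof.
case=> KT TE.
suff [T' KT' T'E] : exists2 T', KKD D T' & forall s d, T'.[? (s, d)] =
    if d == b then processed D M r.+1 d s else T.[? (s, d)].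
  exists T'; split=> // s d; rewrite T'E TE; case: eqP => [->|ne].
    by rewrite leqnn.
  by congr (processed _ _ (if _ then _ else _)); lia.
have TbE s : T.[? (s, b)] = processed D M r b s by rewrite TE ltnn.
have same : (forall s, processed D M r b s = processed D M r.+1 b s) ->
    exists2 T', KKD D T' & forall s d, T'.[? (s, d)] =
    if d == b then processed D M r.+1 d s else T.[? (s, d)].
  by move=> e; exists T => // s d; case: eqP => [->|//]; rewrite -e.
case E: (dark_row M b) => [k|]; last first.
  by apply: same => s; rewrite /processed E.
have kM : (k, b) \in M by rewrite -(dark_rowP _ _ darkM) E.
case: (leqP k r) => [le_kr|lt_rk].
  apply: same => s; rewrite /processed E le_kr leqW //.
  by rewrite (minn_idPr le_kr) (minn_idPr (leqW le_kr)).
have minE : minn r k = r by lia.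
have minSE : minn r.+1 k = r.+1 by lia.
have le_o := ordinary_upto_le D r b.
case: (boolP (skew_cell n L R r.+1 b)) => [rb|rb]; last first.
  apply: same => s; rewrite /processed E minE minSE ordinary_uptoS ordinary_skew.
  rewrite (negbTE rb) addn0 (leqNgt k r) lt_rk /=.
  case: (ltngtP k r.+1) lt_rk => // [lt_rk|ek] _; last first.
    by move: (dark_cell kM); rewrite ek (negbTE rb).
  case: (eqVneq s r.+1) => [->|ne].
    rewrite ltnn leqnn /= ltnNge le_o /=.
    by case: skewD => -> _ _; rewrite (negbTE rb).
  by have -> : (0 < s <= r.+1) = (0 < s <= r) by lia.
(* Ghost moves are used exactly when the cell is the dark cloud. It lands on the stack formed by the
   lower cells of column [b]. *)
have [|||| T' KT' T'E] := @KKD_drop D (k == r.+1) T r.+1 b (ordinary_upto D r b) KT.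
- by lia.
- rewrite TbE /processed E minE ltnn andbF.
  by apply/eqP; rewrite ordinary_skew.
- move=> s sP; rewrite TbE /processed E minE (leqNgt k r) lt_rk.
  by do 2!(case: ifP; try lia).
- move=> s d sP lt_bd; rewrite TE lt_bd.
  exact: processed_right kM lt_rk rb lt_bd sP.
exists T' => // s d; rewrite T'E; case: eqP => // ->.
rewrite TbE /processed E minE minSE ordinary_uptoS ordinary_skew rb addn1.
have -> : (k <= r.+1) = (k == r.+1) by lia.
rewrite (leqNgt k r) lt_rk.
case: (eqVneq s (ordinary_upto D r b).+1) => [->|ne].
  have -> : 0 < (ordinary_upto D r b).+1 <= r.+1 by lia.
  by rewrite leqnn.
have -> : (s <= (ordinary_upto D r b).+1) = (s <= ordinary_upto D r b) by lia.
case: (leqP s (ordinary_upto D r b)) => [le_s|lt_s].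
  have -> : ((ordinary_upto D r b).+1 < s <= r.+1) = false by lia.
  by have -> : (0 < s <= r.+1) = (0 < s <= r) by lia.
have -> : ((ordinary_upto D r b).+1 < s <= r.+1) = (s <= r.+1) by lia.
have -> : (0 < s <= r.+1) = (s <= r.+1) by lia.
by case: ifP => // gt_s; have -> : (0 < s <= r) = false by lia.
Qed.

Lemma KKD_processed : exists2 T, KKD D T & forall s c, T.[? (s, c)] = processed D M n c s.
Proof.
(* [W] exceeds every occupied column, so the sweep of a row can start there with nothing treated. *)
have [W Wmax] : exists W, forall k c, skew_cell n L R k c -> c < W.
  exists (\max_(k < n.+1) R k).+1 => k c /and3P[kn _ le_cR]; rewrite ltnS.
  have lt_k : k < n.+1 by case/andP: kn.
  by apply: leq_trans le_cR (leq_bigmax_cond (Ordinal lt_k) _).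
elim: n => [|r [T KT TE]].
  exists D; first exact: KKD_refl.
  move=> s c; rewrite /processed; case: dark_row => // k.
  by rewrite min0n; case: ifP => //; lia.
have : exists T, sweep r W T.
  exists T; split=> // s c; rewrite TE; case: leqP => // le_W.
  rewrite /processed; case E: dark_row => [k|//].
  have /dark_cell /Wmax : (k, c) \in M by rewrite -(dark_rowP _ _ darkM) E.
  by lia.
elim: W {Wmax} => [[T' [KT' T'E]]|b IH [T' /sweep_step]]; last exact: IH.
by exists T'.
Qed.

Lemma count_empty_below k c : skew_cell n L R k c ->
  count (fun s => is_empty D (s, c)) (iota 1 k.-1) = k - ordinary_upto D k c.
Proof.
case: k => [/andP[]//|k] kc.
rewrite ordinary_uptoS ordinary_skew kc addn1 subSS /=.
rewrite -{2}(size_iota 1 k) -(count_predC (fun s => D.[? (s, c)] == Some Ordinary)).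
rewrite -/(ordinary_upto D k c) addKn; apply: eq_count => s /=.
by rewrite /is_empty; case: skewD => -> _ _; case: ifP.
Qed.

Lemma dark_leq_MaxG :
  sumn [seq k.1 - ordinary_upto D k.1 k.2 | k <- enum_fset M] <= MaxG D.
Proof.
have [T KT TE] := KKD_processed.
rewrite /MaxG; case: ex_maxnP => m _ mmax.
apply: (@leq_trans #|` ghosts T|); last by apply: mmax; apply/asboolP; exists T.
(* The rows of the ghosts left by the dark cloud [q], above a stack that includes the cloud
   itself. *)
pose rows (q : position) := iota (ordinary_upto D q.1 q.2).+1 (q.1 - ordinary_upto D q.1 q.2).
have -> : [seq k.1 - ordinary_upto D k.1 k.2 | k <- enum_fset M] =
    [seq size (rows k) | k <- enum_fset M].
  by apply: eq_map => k; rewrite size_iota.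
rewrite -(size_allpairs_dep (fun (q : position) (s : nat) => (s, q.2) : position)).
apply: uniq_leq_size.
  apply: allpairs_uniq_dep; [exact: fset_uniq|by move=> q _; exact: iota_uniq|].
  move=> _ _ /allpairsPdep[[k c] [s [kM _ ->]]] /allpairsPdep[[l d] [t [lM _ ->]]] /=.
  case=> e1 e2; rewrite e1 -e2 in lM *.
  by case: darkM => _ col _ _; rewrite (col _ _ _ kM lM).
move=> _ /allpairsPdep[[k c] [s [kM + ->]]]; rewrite mem_iota /= => sP.
have kn : k <= n by case/andP: (dark_cell kM) => /andP[].
have Ts : T.[? (s, c)] = Some Ghost.
  rewrite TE /processed; move: (kM); rewrite -(dark_rowP _ _ darkM) => /eqP ->.
  rewrite (minn_idPr kn) kn.
  by do 2!(case: ifP; try lia).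
by rewrite /ghosts !inE /= /is_ghost Ts eqxx -fndSome Ts.
Qed.

(** * Bounding the number of ghosts *)

Lemma count_add_le (s : seq nat) (a b a' b' : pred nat) :
  {in s, forall j, a j + b j <= a' j + b' j} ->
  count a s + count b s <= count a' s + count b' s.
Proof.
elim: s => //= x s IH le_s; have := le_s _ (mem_head x s).
have: count a s + count b s <= count a' s + count b' s.
  by apply: IH => j js; apply: le_s; rewrite in_cons js orbT.
lia.
Qed.

(** * Row ranks, frontiers and the invariant of the moves *)

Definition rows_left c : nat := count (fun j => skew_row n L R j && (R j < c)) (iota 1 n).

Definition row_rank k : nat := count (fun j => skew_row n L R j && (j <= k)) (iota 1 n).

Lemma ordinary_upto_skew r c :
  ordinary_upto D r c = count (fun j => skew_cell n L R j c && (j <= r)) (iota 1 n).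
Proof.
rewrite /ordinary_upto -!size_filter; apply/perm_size/uniq_perm; rewrite ?filter_uniq ?iota_uniq //.
move=> j; rewrite !mem_filter !mem_iota ordinary_skew.
by case: (boolP (skew_cell n L R j c)) => //; rewrite /skew_cell; lia.
Qed.

(** Since starts increase, a nonzero row up to [k] either ends left of column [c] or contains it;
    since ends increase, no nonzero row above [k] ends left of [c]. The right side is thus the same
    in every column of row [k]. *)
Lemma row_rank_cell k c : skew_cell n L R k c ->
  row_rank k = rows_left c + ordinary_upto D k c.
Proof.
case: skewD => _ Lh Rh kc; rewrite /row_rank /rows_left ordinary_upto_skew.
have pt j : j \in iota 1 n -> (skew_row n L R j && (j <= k)) + pred0 j =
    (skew_row n L R j && (R j < c)) + (skew_cell n L R j c && (j <= k)).
  rewrite mem_iota => jn; move: kc; rewrite /skew_row /skew_cell /= => kc.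
  case: (leqP j k) => [/Lh /= le_L|lt_kj]; first by lia.
  case: (leqP (L j) (R j)) => [Lj|]; last by lia.
  by have := Rh k j; rewrite /skew_row Lj; lia.
have e0 := count_pred0 (iota 1 n).
by apply/eqP; rewrite -[X in X == _]addn0 -[X in _ + X == _]e0 eqn_leq; apply/andP; split; apply: count_add_le => j /pt ->.
Qed.

(* Counting the cells of each column from the bottom, cells of one skew row are
   aligned once [rows_left] is added; the cells of a row keep weakly descending
   from left to right. *)
Definition frontier T r c : nat := rows_left c + ordinary_upto T r c.

(** A row counted at [c] either still contains column [d] or has ended before it and enters
    [rows_left d]. *)
Lemma frontier_skew_homo r c d : c <= d -> frontier D r c <= frontier D r d.
Proof.
case: skewD => _ Lh _ le_cd; rewrite /frontier /rows_left !ordinary_upto_skew.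
apply: count_add_le => j _; rewrite /skew_row /skew_cell; lia.
Qed.

(** [frontier T r.-1 c] is the rank of the label of a ghost at [(r, c)]. The third clause makes
    labels increase strictly along a row; the fourth makes the label at least [r]. *)
Definition ghost_invariant T : Prop :=
  [/\ forall r c, ordinary_upto D r c <= ordinary_upto T r c <= ordinary_upto D n c,
      forall r c d, c <= d -> frontier T r c <= frontier T r d,
      forall r c d, c < d -> is_ghost T (r, c) -> is_ghost T (r, d) ->
        frontier T r.-1 c < frontier T r.-1 d &
      forall r c, is_ghost T (r, c) -> 0 < r /\ ordinary_upto D r.-1 c < ordinary_upto T r.-1 c].

Lemma ordinary_upto_lip T r m c : ordinary_upto T (r + m) c <= ordinary_upto T r c + m.
Proof.
elim: m => [|m IH]; first by rewrite !addn0.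
by rewrite addnS ordinary_uptoS; case: eqP => _; lia.
Qed.

(** Counts grow in column [c] only, which threatens just its comparison with columns to the right.
    There row [r] is empty, while column [c] is full from row [r'.+1] to row [r], so the old
    frontiers leave one unit to spare. *)
Lemma ghost_invariant_kmove g T r c r' :
  ghost_invariant T -> can_move T r c r' -> ghost_invariant (kmove g T r c r').
Proof.
case=> i0 i1 i2 i3 [[nE rgt] nG [r'0 lt_r emp ful] nGs].
have ord s : ~~ is_empty T (s, c) -> ~~ is_ghost T (s, c) -> T.[? (s, c)] = Some Ordinary.
  by rewrite /is_empty /is_ghost; case: (T.[? _]) => [[]|].
have Trc := ord _ nE nG.
have Ts s : r' < s <= r -> T.[? (s, c)] = Some Ordinary.
  move=> /andP[lt_s]; rewrite leq_eqVlt => /orP[/eqP ->//|lt_sr].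
  by apply: ord; [apply: ful | apply: nGs].
set T' := kmove g T r c r'.
have T'E p : T'.[? p] = if p == (r, c) then trace g
    else if p == (r', c) then Some Ordinary else T.[? p] by exact: fnd_kmove.
have cnt s d : ordinary_upto T' s d = ordinary_upto T s d + ((d == c) && (r' <= s < r)).
  elim: s => [|s IH]; first by rewrite /ordinary_upto /=; lia.
  rewrite !ordinary_uptoS IH T'E !xpair_eqE.
  case: (eqVneq d c) => [->|_]; rewrite ?andbF ?andbT /=; last by lia.
  case: (eqVneq s.+1 r) => [e|ne1]; first by rewrite e Trc eqxx; case: (g) => /=; lia.
  case: (eqVneq s.+1 r') => [e|ne2]; last by lia.
  by move: emp; rewrite e /is_empty => /eqP ->; rewrite eqxx /=; lia.
have gh p : is_ghost T' p -> p = (r, c) \/ is_ghost T p.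
  rewrite /is_ghost T'E; case: (eqVneq p (r, c)) => [->|_]; first by left.
  by case: ifP => // _; right.
(* A ghost affected by the change would lie inside the moved block, which consists of ordinary
   cells. *)
have old s d : is_ghost T (s, d) -> ordinary_upto T' s.-1 d = ordinary_upto T s.-1 d.
  move=> G; rewrite cnt; case: (eqVneq d c) G => [->|_] G; rewrite ?addn0 //=.
  case: (boolP (r' <= s.-1 < r)) => [sP|_]; last by rewrite addn0.
  by move: G; rewrite /is_ghost Ts //; lia.
have blk s : r' <= s <= r -> ordinary_upto T s c + (r - s) <= ordinary_upto T r c.
  move=> sP; have := subnKC (proj2 (andP sP)); move: (r - s) => m.
  elim: m s sP => [|m IH] s sP e; first by rewrite -e !addn0.
  have sP' : r' < s.+1 <= r by lia.
  have : ordinary_upto T s.+1 c + m <= ordinary_upto T r c by apply: IH; lia.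
  by rewrite ordinary_uptoS Ts // eqxx; lia.
have new : ordinary_upto T' r.-1 c = (ordinary_upto T r.-1 c).+1.
  by rewrite cnt eqxx; lia.
split.
- move=> s d; rewrite cnt; have := i0 s d.
  case: (eqVneq d c) => [->|_] /=; last by lia.
  case: (boolP (r' <= s < r)) => [sP|_]; last by lia.
  by have := blk s; have := i0 r c; lia.
- move=> s d e; rewrite leq_eqVlt => /orP[/eqP ->//|lt_de].
  rewrite /frontier !cnt; have := i1 s d e (ltnW lt_de); rewrite /frontier.
  case: (eqVneq d c) => [e_dc|_] /=; last by lia.
  case: (boolP (r' <= s < r)) => [sP|_] /=; last by lia.
  rewrite e_dc in lt_de *; have := blk s; have := i1 r c e (ltnW lt_de).
  have := ordinary_upto_lip T s (r.-1 - s) e.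
  have : ordinary_upto T r e = ordinary_upto T r.-1 e.
    have {1}-> : r = r.-1.+1 by lia.
    rewrite ordinary_uptoS prednK; last by lia.
    by move: (rgt _ lt_de); rewrite /is_empty => /eqP ->; rewrite addn0.
  by rewrite /frontier subnKC; lia.
- move=> s d e lt_de /gh[[e3 e4]|Gd] /gh[[e1 e2]|Ge].
  + by lia.
  + rewrite e3 e4 in Ge lt_de *.
    by move: (rgt _ lt_de) Ge; rewrite /is_empty /is_ghost => /eqP ->.
  + rewrite e1 e2 in Gd lt_de *; rewrite /frontier old // new.
    by have := i1 r.-1 d c (ltnW lt_de); rewrite /frontier; lia.
  + by rewrite /frontier !old //; exact: i2 lt_de Gd Ge.
- move=> s d /gh[[-> ->]|G]; last by rewrite old //; exact: i3.
  by rewrite new ltnS; split; [lia | case/andP: (i0 r.-1 c)].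
Qed.

Lemma KKD_ghost_invariant T : KKD D T -> ghost_invariant T.
Proof.
elim=> [|{}T r c r' _ inv mv|{}T r c r' _ inv mv]; last 2 first.
- exact: (@ghost_invariant_kmove false) inv mv.
- exact: (@ghost_invariant_kmove true) inv mv.
have noG p : is_ghost D p = false.
  by case: p => k c; rewrite /is_ghost; case: skewD => -> _ _; case: ifP.
split=> [r c|r c d|r c d|r c]; rewrite ?noG //; last exact: frontier_skew_homo.
rewrite leqnn !ordinary_upto_skew; apply: sub_count => j /= /andP[].
by rewrite /skew_cell; lia.
Qed.

(** * Koenig covers and weights *)

Definition right_of s c : Prop := forall d, skew_cell n L R s d -> d < c.

Definition dark_from k c : Prop := exists2 l, k <= l & (l, c) \in M.

(* For fixed [s], the columns [c] with [cover_col s c] and the rows [k] with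
   [cover_row s k] form a Koenig vertex cover of the cells of D that lie above
   an empty position of row [s]; distinct members of the cover are matched by
   distinct dark clouds. *)
Definition cover_col s c : Prop := right_of s c /\ exists k, [/\ s < k, L k <= c &
  forall d, right_of s d -> L k <= d <= c -> dark_from k d].

Definition cover_row s k : Prop :=
  exists c, [/\ skew_cell n L R k c, right_of s c & ~ cover_col s c].

Lemma dark_dominates k c : skew_cell n L R k c ->
  (exists2 d, c <= d & (k, d) \in M) \/ (exists2 l, k < l & (l, c) \in M).
Proof.
move=> kc; case: darkM => _ _ _; apply; first by rewrite skew_cellE.
by case/andP: kc => /andP[].
Qed.

(** As [k] does not witness that column [c] is covered, some cell of row [k] weakly left of [c] has
    no dark cloud at or above it, so row [k] has a dark cloud weakly right of that cell. A witness
    [j] covering the column of this cloud would also cover [c]: beyond the cloud, cells of row [k]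
    lie below dark clouds. *)
Lemma cover_row_dark s k : s < k -> cover_row s k ->
  exists d, [/\ (k, d) \in M, right_of s d & ~ cover_col s d].
Proof.
move=> lt_sk [c [kc rc nc]].
have [d [le_dc Lkd rd nd]] : exists d, [/\ d <= c, L k <= d, right_of s d & ~ dark_from k d].
  apply: contrapT => H; apply: nc; split=> //; exists k; split=> //.
    by move: kc; rewrite /skew_cell; lia.
  move=> d rd dP; apply: contrapT => nd; apply: H; exists d; split=> //; lia.
have kd : skew_cell n L R k d by move: kc; rewrite /skew_cell; lia.
case: (dark_dominates kd) => [[e le_de eM]|[l lt_kl lM]]; last first.
  by case: nd; exists l => //; exact: ltnW.
exists e; have re : right_of s e by move=> f /rd; lia.
split=> // -[_ [j [lt_sj Lj dark_j]]].
have [l le_jl lM] : dark_from j e by apply: dark_j => //; lia.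
have e_lk : l = k by case: darkM => _ col _ _; exact: col lM eM.
rewrite {}e_lk in le_jl lM; apply: nc; split=> //; exists j.
have LL : L j <= L k by case: skewD => _ Lh _; exact: Lh.
split=> //; first by lia.
move=> f rf fP; case: (leqP f e) => [le_fe|lt_ef]; first by apply: dark_j => //; lia.
have kf : skew_cell n L R k f.
  by have := dark_cell eM; move: kc; rewrite /skew_cell; lia.
by have [m lt_km] := dark_above eM lt_ef kf; exists m => //; lia.
Qed.

Lemma right_of_empty s k c : skew_cell n L R k c -> 0 < s < k ->
  ~~ skew_cell n L R s c -> right_of s c.
Proof.
move=> kc sP nc d sd; rewrite ltnNge; apply/negP => le_cd; case/negP: nc.
by apply: (skew_left kc le_cd _ sd); lia.
Qed.

Lemma cover_cell s k c : skew_cell n L R k c -> 0 < s < k ->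
  ~~ skew_cell n L R s c -> cover_row s k \/ cover_col s c.
Proof.
move=> kc sP nc; case: (pselect (cover_col s c)) => [|ncc]; first by right.
by left; exists c; split=> //; exact: right_of_empty kc sP nc.
Qed.

Lemma cover_col_dark s c : cover_col s c ->
  ~~ skew_cell n L R s c /\ exists2 k, s < k & (k, c) \in M.
Proof.
case=> rc [k [lt_sk Lk dark_k]]; split.
  by apply/negP => /rc; rewrite ltnn.
have [l le_kl lM] : dark_from k c by apply: dark_k; rewrite ?Lk ?leqnn.
by exists l => //; exact: leq_trans lt_sk le_kl.
Qed.

(** The sizes of these lists are the weights y and w; their entries are the rows to which ghosts get
    charged. *)
Definition row_weight k : seq nat := [seq s <- iota 1 k.-1 | `[< cover_row s k >]].

Definition col_weight c : seq nat := [seq s <- iota 1 n | `[< cover_col s c >]].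

Lemma weights_cover k c : skew_cell n L R k c ->
  k - ordinary_upto D k c <= size (row_weight k) + size (col_weight c).
Proof.
move=> kc; have kn : 0 < k <= n by case/andP: kc.
rewrite -(count_empty_below kc) !size_filter.
apply: (@leq_trans (count (fun s => `[< cover_row s k >]) (iota 1 k.-1) +
                    count (fun s => `[< cover_col s c >]) (iota 1 k.-1))).
  rewrite -[X in X <= _]addn0 -{2}(count_pred0 (iota 1 k.-1)).
  apply: count_add_le => s; rewrite mem_iota /= addn0 => sP.
  case E: (is_empty D (s, c)) => //.
  have nc : ~~ skew_cell n L R s c.
    by move: E; rewrite /is_empty; case: skewD => -> _ _; case: ifP.
  have sk : 0 < s < k by lia.
  by case: (cover_cell kc sk nc) => /asboolP ->; rewrite ?addn1.
rewrite leq_add2l -(subnKC (_ : k.-1 <= n)); last by lia.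
by rewrite iotaD count_cat leq_addr.
Qed.

(** * Labels of ghosts and their charges *)

Lemma ghost_label T r c : ghost_invariant T -> is_ghost T (r, c) ->
  exists k, [/\ skew_cell n L R k c, ordinary_upto D k c = ordinary_upto T r.-1 c & r <= k].
Proof.
case=> i0 _ _ i3 G; have [r0 lt_q] := i3 _ _ G.
have ex : exists k, ordinary_upto T r.-1 c <= ordinary_upto D k c.
  by exists n; case/andP: (i0 r.-1 c).
(* The label is the least such row: minimality makes it a cell of column [c], and the strict excess
   in the fourth clause of the invariant puts it at or above row [r]. *)
case: (ex_minnP ex) => -[|k] le_q min_q.
  by move: le_q lt_q; rewrite {2}/ordinary_upto /=; lia.
have lt_k : ordinary_upto D k c < ordinary_upto T r.-1 c.
  by rewrite ltnNge; apply/negP => /min_q; rewrite ltnn.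
exists k.+1; move: le_q; rewrite ordinary_uptoS ordinary_skew.
case: (boolP (skew_cell n L R k.+1 c)) => [kc|_] /= le_q; last by lia.
split=> //; first by lia.
rewrite leqNgt; apply/negP => lt_kr.
have := @ordinary_upto_homo D c k.+1 r.-1.
rewrite ordinary_uptoS ordinary_skew kc; lia.
Qed.

(* The ghost in row r and column c, of label k, fills the (k+1-r)-th empty
   position of column c below row k counted from the top, and the
   (r - ordinary_upto T r.-1 c)-th one counted from the bottom.  It is charged
   to row k or to column c according to which of these two ranks is covered. *)
Definition charged T (p q : position) : Prop :=
  exists k, [/\ skew_cell n L R k p.2,
    ordinary_upto D k p.2 = ordinary_upto T p.1.-1 p.2, p.1 <= k &
    [/\ k - p.1 < size (row_weight k), q.1 = nth 0 (row_weight k) (k - p.1),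
        (k, q.2) \in M & ~ cover_col q.1 q.2] \/
    [/\ q.2 = p.2, cover_col q.1 q.2,
        (p.1 - ordinary_upto T p.1.-1 p.2).-1 < size (col_weight p.2) &
        q.1 = nth 0 (col_weight p.2) (p.1 - ordinary_upto T p.1.-1 p.2).-1]].

Lemma charged_total T p : ghost_invariant T -> is_ghost T p -> exists q,
  charged T p q /\ [/\ 0 < q.1, ~~ skew_cell n L R q.1 q.2 &
    exists2 k, q.1 < k & (k, q.2) \in M].
Proof.
case: p => r c inv G; have [k [kc qk le_rk]] := ghost_label inv G.
have r0 : 0 < r by case: inv => _ _ _ /(_ _ _ G)[].
have le_qr := ordinary_upto_le T r.-1 c.
have := weights_cover kc; rewrite qk => le_w.
(* The zero-based indices [k - r] and [(r - ordinary_upto T r.-1 c).-1] add up to one less than the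
   bound of [weights_cover], so one of them is in range. *)
case: (ltnP (k - r) (size (row_weight k))) => [lt_t|ge_t].
  have := mem_nth 0 lt_t; set s := nth _ _ _.
  rewrite mem_filter mem_iota => /andP[/asboolP row_s sP].
  have lt_sk : s < k by lia.
  have [d [dM rd nd]] := cover_row_dark lt_sk row_s.
  exists (s, d); split; first by exists k; split=> //; left.
  split; [by case/andP: sP | by apply/negP => /rd; rewrite ltnn | by exists k].
have lt_u : (r - ordinary_upto T r.-1 c).-1 < size (col_weight c) by lia.
have := mem_nth 0 lt_u; set s := nth _ _ _.
rewrite mem_filter mem_iota => /andP[/asboolP col_s /andP[s0 _]].
have [ns exk] := cover_col_dark col_s.
by exists (s, c); split=> //; exists k; split=> //; right.
Qed.

(** Whether [cover_col q.1 q.2] holds tells the kind of charge. A row charge determines [k] through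
    its dark cloud, then the row of the ghost, then its column because labels increase along a row.
    A column charge determines the column, then the row. *)
Lemma charged_inj T p p' q : ghost_invariant T -> is_ghost T p -> is_ghost T p' ->
  charged T p q -> charged T p' q -> p = p'.
Proof.
case: p p' q => r c [r' c'] [s d] inv G G' [k [kc qk le_rk H]] [k' [kc' qk' le_rk' H']].
have uY l : uniq (row_weight l) by rewrite filter_uniq ?iota_uniq.
have uW l : uniq (col_weight l) by rewrite filter_uniq ?iota_uniq.
rewrite /= in kc qk le_rk H kc' qk' le_rk' H'.
case: H H' => [[lt_t es kM nd]|[ed cd lt_u es]] [[lt_t' es' kM' nd']|[ed' cd' lt_u' es']] //.
  have ek : k' = k by case: darkM => _ col _ _; exact: col kM' kM.
  rewrite {}ek in kc' qk' le_rk' lt_t' es' kM'.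
  have : k - r == k - r' by rewrite -(nth_uniq 0 lt_t lt_t') // -es -es'.
  move=> /eqP et; have er : r' = r by lia.
  rewrite {}er in G' qk' le_rk' lt_t' es' et *; congr pair.
  have := row_rank_cell kc; rewrite (row_rank_cell kc') qk qk' => eF.
  case: inv => _ _ i2 _.
  case: (ltngtP c c') => // lt_cc.
    by have := i2 _ _ _ lt_cc G G'; rewrite /frontier eF ltnn.
  by have := i2 _ _ _ lt_cc G' G; rewrite /frontier eF ltnn.
have ec : c' = c by rewrite -ed -ed'.
rewrite {}ec in G' kc' qk' ed' lt_u' es' *; congr pair.
have : (r - ordinary_upto T r.-1 c).-1 == (r' - ordinary_upto T r'.-1 c).-1.
  by rewrite -(nth_uniq 0 lt_u lt_u') // -es -es'.
have r0 : 0 < r by case: inv => _ _ _ /(_ _ _ G)[].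
have r0' : 0 < r' by case: inv => _ _ _ /(_ _ _ G')[].
have le_q := ordinary_upto_le T r.-1 c; have le_q' := ordinary_upto_le T r'.-1 c.
(* The row of a ghost contributes no ordinary cell, so the rank from the bottom strictly increases
   along the ghosts of a column. *)
have gap i j : 0 < i -> i < j -> is_ghost T (i, c) ->
    ordinary_upto T j.-1 c + i < ordinary_upto T i.-1 c + j.
  move=> i0 lt_ij Gi; have := ordinary_upto_lip T i (j.-1 - i) c.
  rewrite subnKC; last by lia.
  have : ordinary_upto T i c = ordinary_upto T i.-1 c.
    rewrite -[in LHS](prednK i0) ordinary_uptoS prednK //.
    by move: Gi; rewrite /is_ghost => /eqP ->; rewrite addn0.
  lia.
case: (ltngtP r r') => // lt_r /eqP eu.
  by have := gap _ _ r0 lt_r G; lia.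
by have := gap _ _ r0' lt_r G'; lia.
Qed.
End SkewShape.

(** * Comparison of both bounds with the snowflake count *)

Lemma leq_card_rel (A B : {fset position}) (Rel : position -> position -> Prop) :
  (forall p, p \in A -> exists2 q, q \in B & Rel p q) ->
  (forall p p' q, p \in A -> p' \in A -> Rel p q -> Rel p' q -> p = p') ->
  #|` A| <= #|` B|.
Proof.
move=> tot inj.
have [p|f fP] := @choice _ _ (fun p q => p \in A -> q \in B /\ Rel p q).
  case: (boolP (p \in A)) => [/tot[q qB pq]|_]; first by exists q.
  by exists p.
rewrite -(size_map f); apply: uniq_leq_size.
  rewrite map_inj_in_uniq ?fset_uniq // => p p' pA pA' e.
  have [_ Rp] := fP _ pA; have [_ Rp'] := fP _ pA'.
  by apply: inj pA pA' Rp _; rewrite e.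
by move=> _ /mapP[p pA ->]; case: (fP _ pA).
Qed.

Lemma sf_skew n L R D : skew_shaped n L R D ->
  sf D <= sumn [seq k.1 - ordinary_upto D k.1 k.2 | k <- enum_fset (dark_clouds D)].
Proof.
move=> skewD; pose rows (q : position) := [seq s <- iota 1 q.1.-1 | is_empty D (s, q.2)].
have -> : [seq k.1 - ordinary_upto D k.1 k.2 | k <- enum_fset (dark_clouds D)] =
    [seq size (rows k) | k <- enum_fset (dark_clouds D)].
  apply/eq_in_map => -[k c] kM /=; rewrite size_filter.
  by rewrite (count_empty_below skewD) //; exact: (dark_cell skewD (dark_cloudsP D)).
rewrite -(size_allpairs_dep (fun (q : position) (s : nat) => (s, q.2) : position)).
apply: uniq_leq_size; first exact: fset_uniq.
move=> p; rewrite /snowflakes inE /= inE => /andP[/allpairsPdep[q [s [qM sP ->]]] emp].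
by apply/allpairsPdep; exists q, s; rewrite mem_filter sP andbT.
Qed.

Lemma ghosts_le_sf n L R D T : skew_shaped n L R D -> KKD D T -> #|` ghosts T| <= sf D.
Proof.
move=> skewD KT; have darkM := dark_cloudsP D.
have inv := KKD_ghost_invariant skewD KT.
have gh p : p \in ghosts T -> is_ghost T p by rewrite !inE => /andP[].
apply: (@leq_card_rel _ _ (charged n L R D (dark_clouds D) T)) => [p|p p' q] /gh G.
  have [q [pq [q0 nq [k lt_k kM]]]] := charged_total skewD darkM inv G.
  exists q => //; rewrite /snowflakes inE /= inE; apply/andP; split.
    apply/allpairsPdep; exists (k, q.2), q.1; rewrite mem_iota /=; split=> //; first by lia.
    by case: q {pq q0 nq lt_k kM}.
  case: q nq {pq q0 lt_k kM} => s c /= nq.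
  by rewrite /is_empty; case: skewD => -> _ _; rewrite (negbTE nq).
by move=> /gh G' pq p'q; exact: (charged_inj skewD darkM inv G G' pq p'q).
Qed.

Theorem theorem3p4 (alpha : seq nat) : MaxG (skew alpha) = sf (skew alpha).
Proof.
have skewD := skew_skew_shaped alpha.
apply/eqP; rewrite eqn_leq; apply/andP; split.
  rewrite /MaxG; case: ex_maxnP => m /asboolP[T KT <-] _.
  exact: ghosts_le_sf skewD KT.
apply: leq_trans (sf_skew skewD) _.
exact: dark_leq_MaxG skewD (dark_cloudsP _).
Qed.
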